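(* Let $\mathcal{E}$ be an ellipse with semi-axes $a,b$ and center $O$, let $\mathcal{E}'$ be a circle of radius $r$ with the same center $O$, with $a>b>r>0$, and suppose that the pair admits a Poncelet 3-periodic family $\mathcal{F}$, i.e. a one-parameter family of triangles inscribed in $\mathcal{E}$ and circumscribed about $\mathcal{E}'$. For a triangle $P_1P_2P_3$ of $\mathcal{F}$ and $i=1,2,3$, let $P_i'$ be the excenter opposite $P_i$, let $\Delta_i$ be the area of the circumellipse of $P_1P_2P_3$ centered at $P_i'$, let $\Omega_i$ be the area of the excircle of $P_1P_2P_3$ centered at $P_i'$, and let $\rho=r/R$ be the ratio of the inradius to the circumradius of $P_1P_2P_3$. Then for every triangle of $\mathcal{F}$, $$\frac{\Delta_1}{\Omega_1}+\frac{\Delta_2}{\Omega_2}+\frac{\Delta_3}{\Omega_3}=\frac{2}{\rho}.$$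
   Context: A Poncelet 3-periodic family of $(\mathcal{E},\mathcal{E}')$: every point of $\mathcal{E}$ is a vertex of a triangle whose three vertices lie on $\mathcal{E}$ and whose three sides are tangent to $\mathcal{E}'$; the family is the set of all such triangles. For an ellipse with semi-axes $a,b$ and a concentric circle of radius $r$ as here, such a family exists exactly when $r=\frac{ab}{a+b}$. The circle $\mathcal{E}'$ is the incircle of every triangle of $\mathcal{F}$. It is known that the circumradius of every triangle of $\mathcal{F}$ is $R=\frac{ab}{2r}=\frac{a+b}{2}$, so $\rho=\frac{2r^2}{ab}$ is constant over $\mathcal{F}$. A circumellipse of a triangle is an ellipse passing through its three vertices; the circumellipse centered at a given point is the one having that point as its center. *)

(* Defs.v *)
From HB Require Import structures.
From mathcomp Require Import all_boot all_order all_algebra.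
From mathcomp Require Import all_classical all_reals all_analysis.

Set Implicit Arguments.
Unset Strict Implicit.
Unset Printing Implicit Defensive.

Import Order.TTheory GRing.Theory Num.Theory.

Local Open Scope classical_set_scope.
Local Open Scope ring_scope.

Definition plane (R : realType) : Type := (R * R)%type.

Definition area (R : realType) (A : set (plane R)) : R :=
  fine ((@lebesgue_measure R \x @lebesgue_measure R)%E A).

Record circle (R : realType) := Circle {
  circle_center : plane R;
  circle_radius : R;
  circle_radius_gt0 : 0 < circle_radius }.

Definition circle_eqn (R : realType) (w : circle R) (X : plane R) : R :=
  ((X.1 - (circle_center w).1) ^+ 2 + (X.2 - (circle_center w).2) ^+ 2)
    / circle_radius w ^+ 2.

Definition on_circle (R : realType) (w : circle R) : set (plane R) :=
  [set X | circle_eqn w X = 1].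

Definition circle_region (R : realType) (w : circle R) : set (plane R) :=
  [set X | circle_eqn w X <= 1].

(* The axis of semi-axis [semi1] has the direction of the unit vector
   [axis_dir]; the two semi-axes come in no prescribed order. *)
Record ellipse (R : realType) := Ellipse {
  ellipse_center : plane R;
  axis_dir : plane R;
  semi1 : R;
  semi2 : R;
  axis_dir_unit : axis_dir.1 ^+ 2 + axis_dir.2 ^+ 2 = 1;
  semi1_gt0 : 0 < semi1;
  semi2_gt0 : 0 < semi2 }.

Definition ellipse_eqn (R : realType) (E : ellipse R) (X : plane R) : R :=
  let x := X.1 - (ellipse_center E).1 in
  let y := X.2 - (ellipse_center E).2 in
  let u := axis_dir E in
  ((x * u.1 + y * u.2) / semi1 E) ^+ 2 + ((y * u.1 - x * u.2) / semi2 E) ^+ 2.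

Definition on_ellipse (R : realType) (E : ellipse R) : set (plane R) :=
  [set X | ellipse_eqn E X = 1].

Definition ellipse_region (R : realType) (E : ellipse R) : set (plane R) :=
  [set X | ellipse_eqn E X <= 1].

(* Twice the signed area of the triangle PQX. *)
Definition orient (R : realType) (P Q X : plane R) : R :=
  (Q.1 - P.1) * (X.2 - P.2) - (Q.2 - P.2) * (X.1 - P.1).

Definition line (R : realType) (P Q : plane R) : set (plane R) :=
  [set X | orient P Q X = 0].

Definition tangent_line (R : realType) (P Q : plane R) (w : circle R) : Prop :=
  exists! X : plane R, line P Q X /\ on_circle w X.

Definition same_side (R : realType) (P Q X Y : plane R) : Prop :=
  0 < orient P Q X * orient P Q Y.

Definition opposite_sides (R : realType) (P Q X Y : plane R) : Prop :=
  orient P Q X * orient P Q Y < 0.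

(* Vertices are indexed cyclically: arithmetic on ['I_3] is modulo 3, so the
   side opposite [T i] joins [T (i + 1)] and [T (i - 1)]. *)
Definition nondegenerate_triangle (R : realType) (T : 'I_3 -> plane R) : Prop :=
  orient (T 0) (T 1) (T (- 1)) != 0.

Definition tangent_to_sides (R : realType) (T : 'I_3 -> plane R) (w : circle R)
    : Prop :=
  forall i : 'I_3, tangent_line (T (i + 1)) (T (i - 1)) w.

Definition circumcircle (R : realType) (T : 'I_3 -> plane R) (w : circle R)
    : Prop :=
  forall i : 'I_3, on_circle w (T i).

(* The circle tangent to the three side lines whose center is inside T. *)
Definition incircle (R : realType) (T : 'I_3 -> plane R) (w : circle R)
    : Prop :=
  tangent_to_sides T w /\
  forall i : 'I_3,
    same_side (T (i + 1)) (T (i - 1)) (T i) (circle_center w).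

(* The circle tangent to the three side lines whose center is inside the angle
   at [T i] but beyond the opposite side; its center is the excenter opposite
   [T i]. *)
Definition excircle (R : realType) (T : 'I_3 -> plane R) (i : 'I_3)
    (w : circle R) : Prop :=
  [/\ tangent_to_sides T w,
      opposite_sides (T (i + 1)) (T (i - 1)) (T i) (circle_center w) &
      forall j : 'I_3, j != i ->
        same_side (T (j + 1)) (T (j - 1)) (T j) (circle_center w)].

Definition circumellipse (R : realType) (T : 'I_3 -> plane R) (c : plane R)
    (D : ellipse R) : Prop :=
  ellipse_center D = c /\ forall i : 'I_3, on_ellipse D (T i).

Definition poncelet_triangle (R : realType) (E : ellipse R) (E' : circle R)
    (T : 'I_3 -> plane R) : Prop :=
  [/\ nondegenerate_triangle T, forall i : 'I_3, on_ellipse E (T i) &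
      tangent_to_sides T E'].

Definition poncelet3 (R : realType) (E : ellipse R) (E' : circle R) : Prop :=
  forall X : plane R, on_ellipse E X ->
    exists T : 'I_3 -> plane R,
      poncelet_triangle E E' T /\ exists i : 'I_3, T i = X.

Definition associated_curves (R : realType) (T : 'I_3 -> plane R)
    (C I : circle R) (X : 'I_3 -> circle R) (D : 'I_3 -> ellipse R) : Prop :=
  [/\ circumcircle T C, incircle T I, forall i : 'I_3, excircle T i (X i) &
      forall i : 'I_3, circumellipse T (circle_center (X i)) (D i)].

(* Main.v *)
(* The identity holds for every nondegenerate triangle.  Let [l_i] be the side
   lengths, [m] twice the area of the triangle, [L] the product and [p] the sum
   of the [l_i].  A circle of radius [t] tangent to the three sides has
   barycentric coordinates [(+-t l_i / m)_i] for its center; summing them to 1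
   gives [r p = m] for the incircle and [t_i (p - 2 l_i) = m] for the excircles.
   For three points on an ellipse with barycentric center [u], the relation
   [sum u_i d_i = 0] between the radii [d_i] gives
   [4 m^2 (u_0 u_1 u_2)^2
    = (s_1 s_2)^2 (1 - 2 u_0) (1 - 2 u_1) (1 - 2 u_2)].
   At an excenter the right-hand product is given by Heron's formula and
   [s_1 s_2 = t_i L / m], so the ratio of areas is
   [s_1 s_2 / t_i^2 = L (p - 2 l_i) / m^2].  These add up to
   [L p / m^2 = 2 R / r], since [2 R m = L].  The pair of conics only matters for
   identifying the inner circle with the incircle: its tangency points are
   interior to the outer ellipse, hence interior to the sides. *)
Require Import Defs.
From HB Require Import structures.
From mathcomp Require Import all_boot all_order all_algebra.
From mathcomp Require Import all_classical all_reals all_analysis.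
From mathcomp Require Import measurable_realfun ring lra.

Set Implicit Arguments.
Unset Strict Implicit.
Unset Printing Implicit Defensive.

Import Order.TTheory GRing.Theory Num.Theory.
Import numFieldNormedType.Exports.

Local Open Scope ring_scope.

(** * Areas of elliptic regions *)

(** The number pi, kept as an integral of chord lengths; it is a common factor of both areas and
    cancels in each ratio. As [Num.sqrt] is 0 on negative numbers, the integrand vanishes outside
    [-1, 1]. *)
Definition unit_disk_area (R : realType) : R :=
  fine (\int[@lebesgue_measure R]_x (2 * Num.sqrt (1 - x ^+ 2))%:E)%E.

Lemma continuous_disk_section (R : realType) :
  continuous (fun x : R => 2 * Num.sqrt (1 - x ^+ 2)).
Proof.
move=> x; apply: cvgM; first exact: cvg_cst.
apply: continuous_comp; last exact: sqrt_continuous.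
by apply: cvgB; [exact: cvg_cst | exact: exprn_continuous].
Qed.

Lemma measurable_disk_section (R : realType) :
  measurable_fun setT (fun x : R => 2 * Num.sqrt (1 - x ^+ 2)).
Proof.
by apply: continuous_measurable_fun; exact: continuous_disk_section.
Qed.

(** Domination by twice the indicator of [-1, 1] makes the integral finite, so [fine] loses
    nothing. *)
Lemma unit_disk_area_fin (R : realType) :
  (\int[@lebesgue_measure R]_x (2 * Num.sqrt (1 - x ^+ 2))%:E
   = (unit_disk_area R)%:E)%E.
Proof.
rewrite /unit_disk_area fineK// ge0_fin_numE; last first.
  by apply: integral_ge0 => x _; rewrite lee_fin mulr_ge0 ?sqrtr_ge0.
apply: (@le_lt_trans _ _
  (\int[@lebesgue_measure R]_x (2 * \1_`[(-1 : R), 1]%classic x)%:E)%E).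
  apply: ge0_le_integral => //.
  - apply/measurable_EFinP.
    exact: measurable_disk_section.
  - by apply/measurable_EFinP; exact: measurable_funM.
  move=> x _; rewrite lee_fin ler_pM2l// indicE.
  case: (boolP (x \in _)) => [_|].
    rewrite -[leRHS]sqrtr1 ler_sqrt// gerBl sqr_ge0 //.
  rewrite notin_setE/= in_itv/= => /negP; rewrite -ler_norml -ltNge => x1.
  rewrite ler0_sqrtr// subr_le0 -real_normK ?num_real//.
  by rewrite expr_ge1 // ltW.
under eq_integral do rewrite EFinM.
rewrite ge0_integralZl//; last first.
  by apply/measurable_EFinP; exact: measurable_indic.
rewrite integral_indic// setIT.
rewrite [X in (_ * X)%E]lebesgue_measure_itv/= lte_fin gtrN//.
by rewrite -EFinD -EFinM ltry.
Qed.

(** The chord length is at least 1 on [-1/2, 1/2]. *)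
Lemma unit_disk_area_gt0 (R : realType) : 0 < unit_disk_area R.
Proof.
rewrite -lte_fin -unit_disk_area_fin.
apply: (@lt_le_trans _ _
  (\int[@lebesgue_measure R]_x (\1_`[(- 2^-1 : R), 2^-1]%classic x)%:E)%E).
  rewrite integral_indic// setIT.
  by rewrite [X in (_ < X)%E]lebesgue_measure_itv/= lte_fin ifT ?lte_fin; lra.
apply: ge0_le_integral => //.
- by apply/measurable_EFinP; exact: measurable_indic.
- apply/measurable_EFinP.
  exact: measurable_disk_section.
move=> x _; rewrite lee_fin indicE.
case: (boolP (x \in _)) => [|_]; last by rewrite mulr_ge0 ?sqrtr_ge0.
rewrite inE/= in_itv/= => /andP[x1 x2].
suff : 2^-1 <= Num.sqrt (1 - x ^+ 2) by lra.
rewrite -(@ger0_norm _ 2^-1)// -sqrtr_sqr ler_sqrt//; nra.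
Qed.

Lemma integral_affine_disk_section (R : realType) (k p : R) : 0 < k ->
  (\int[@lebesgue_measure R]_x
     (2 * Num.sqrt (1 - (k * (x - p)) ^+ 2) * k)%:E
   = (unit_disk_area R)%:E)%E.
Proof.
move=> k0; rewrite -unit_disk_area_fin.
have dF (x : R) : is_derive x 1 (fun x => k * (x - p)) k.
  by apply: is_derive_eq; rewrite subr0; exact: mulr1.
have F'E : derive1 (fun x : R => k * (x - p)) = cst k.
  by apply/funext => x; rewrite derive1E derive_val.
rewrite (@increasing_ge0_integration_by_substitutionT R
  (fun x => k * (x - p)) (fun x => 2 * Num.sqrt (1 - x ^+ 2)))//.
- by apply: eq_integral => x _ /=; rewrite F'E.
- by move=> x y xy; rewrite ltr_pM2l// ltrD2r.
- by rewrite F'E; exact: cst_continuous.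
- by rewrite F'E; exact: is_cvg_cst.
- by rewrite F'E; exact: is_cvg_cst.
- apply: gt0_cvgMrNy => //; exact: cvg_addrr_Ny.
- apply: gt0_cvgMry => //; exact: cvg_addrr.
- exact: continuous_disk_section.
Qed.

(** For [0 <= q] the set is the interval between the two roots; for [q < 0] it is empty and
    [Num.sqrt q] is 0 by convention. *)
Lemma lebesgue_measure_quadratic (R : realType) (c m q : R) : 0 < c ->
  @lebesgue_measure R [set y | (c * y + m) ^+ 2 <= q]%classic
  = (2 * Num.sqrt q / c)%:E.
Proof.
move=> c0; have [q0|q0] := ltP q 0.
  rewrite ler0_sqrtr 1?ltW// mulr0 mul0r (_ : mkset _ = set0) ?measure0//.
  by apply/seteqP; split => // y /=; rewrite leNgt (lt_le_trans q0)// sqr_ge0.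
rewrite (_ : mkset _ =
  `[(- m - Num.sqrt q) / c, (- m + Num.sqrt q) / c]%classic).
  rewrite [LHS]lebesgue_measure_itv/= lte_fin.
  have := sqrtr_ge0 q; rewrite le_eqVlt => /predU1P[<-|s0].
    by rewrite subr0 addr0 ltxx mulr0 mul0r.
  rewrite ltr_pM2r ?invr_gt0// ifT; last by lra.
  by rewrite -EFinB; congr EFin; field; rewrite gt_eqF.
apply/seteqP; split => y /=; rewrite in_itv/= ler_pdivrMr// ler_pdivlMr//.
  move=> h; have : `|c * y + m| <= Num.sqrt q.
    by rewrite -sqrtr_sqr ler_sqrt.
  by rewrite ler_norml => /andP[? ?]; apply/andP; split; lra.
move=> /andP[h1 h2]; rewrite -(sqr_sqrtr q0) -subr_ge0 subr_sqr.
by apply: mulr_ge0; lra.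
Qed.

(** Completing the square in the second coordinate turns each vertical section into an interval; up
    to a constant factor, its length is a rescaled chord length of the unit disk. *)
Lemma area_quadratic_region (R : realType) (p : plane R) (A B C : R) :
  0 < C -> 0 < A * C - B ^+ 2 ->
  area [set X | A * (X.1 - p.1) ^+ 2 + 2 * B * (X.1 - p.1) * (X.2 - p.2)
    + C * (X.2 - p.2) ^+ 2 <= 1]%classic
  = unit_disk_area R / Num.sqrt (A * C - B ^+ 2).
Proof.
move=> C0 D0; set D := A * C - B ^+ 2 in D0 *.
have sC : 0 < Num.sqrt C by rewrite sqrtr_gt0.
have sD : 0 < Num.sqrt D by rewrite sqrtr_gt0.
have CE := sqr_sqrtr (ltW C0); have DE := sqr_sqrtr (ltW D0).
(* [1 / k] is the half-width of the region along the first axis. *)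
set k := Num.sqrt D / Num.sqrt C.
have k0 : 0 < k by rewrite divr_gt0.
have kE : C * k ^+ 2 = D by rewrite /k expr_div_n CE DE mulrC divfK ?lt0r_neq0.
have section_eq x y : C * (1 - (k * (x - p.1)) ^+ 2)
      - (C * y + (B * (x - p.1) - C * p.2)) ^+ 2
    = C * (1 - (A * (x - p.1) ^+ 2 + 2 * B * (x - p.1) * (y - p.2)
        + C * (y - p.2) ^+ 2)).
  by rewrite exprMn mulrBr (mulrA C) kE /D; ring.
rewrite /area /product_measure1.
under eq_integral => x _.
  rewrite /= /xsection.
  rewrite (_ : (fun y => _) = [set y | (C * y + (B * (x - p.1) - C * p.2)) ^+ 2
      <= C * (1 - (k * (x - p.1)) ^+ 2)]%classic); last first.
    apply/seteqP; split => y /=; rewrite ?inE/= -subr_ge0 => h.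
    - rewrite -subr_ge0; move: (mulr_ge0 (ltW C0) h); congr (0 <= _).
      exact/esym/section_eq.
    - rewrite -subr_ge0 -(pmulr_rge0 _ C0); move: h; congr (0 <= _).
      exact: section_eq.
  rewrite lebesgue_measure_quadratic//.
  rewrite (_ : _ / C = (Num.sqrt D)^-1 *
     (2 * Num.sqrt (1 - (k * (x - p.1)) ^+ 2) * k)); last first.
    rewrite sqrtrM ?ltW// -{2}CE /k; field; apply/andP; split; exact: lt0r_neq0.
  rewrite EFinM.
  over.
rewrite ge0_integralZl//; last 2 first.
- apply/measurable_EFinP; apply: measurable_funM => //.
  apply: (@measurableT_comp _ _ _ _ _ _
    (fun x : R => 2 * Num.sqrt (1 - x ^+ 2))).
    exact: measurable_disk_section.
  by apply: measurable_funM => //; exact: measurable_funB.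
- by move=> x _; rewrite lee_fin !mulr_ge0 ?sqrtr_ge0// ltW.
by rewrite integral_affine_disk_section//= mulrC.
Qed.

(** * Ellipses as positive definite quadratic forms *)

Lemma ellipse_eqn_quadratic (R : realType) (D : ellipse R) :
  exists A B C : R, [/\ 0 < C,
    A * C - B ^+ 2 = (semi1 D * semi2 D) ^- 2 &
    forall X, ellipse_eqn D X =
      let x := X.1 - (ellipse_center D).1 in
      let y := X.2 - (ellipse_center D).2 in
      A * x ^+ 2 + 2 * B * x * y + C * y ^+ 2].
Proof.
case: D => c [u v] s t /= huv s0 t0.
exists ((u / s) ^+ 2 + (v / t) ^+ 2), (u * v * (s ^- 2 - t ^- 2)),
  ((v / s) ^+ 2 + (u / t) ^+ 2).
have s1 := lt0r_neq0 s0; have t1 := lt0r_neq0 t0.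
split.
- rewrite lt0r addr_ge0 ?sqr_ge0// andbT paddr_eq0 ?sqr_ge0// !sqrf_eq0.
  rewrite !mulf_eq0 !invr_eq0 (negPf s1) (negPf t1) !orbF.
  apply/negP => /andP[/eqP v0 /eqP u0]; move: huv.
  by rewrite u0 v0 expr0n addr0 => /esym/eqP; rewrite oner_eq0.
- transitivity ((u ^+ 2 + v ^+ 2) ^+ 2 / (s * t) ^+ 2); last first.
    by rewrite huv expr1n mul1r.
  by field; rewrite s1 t1.
- by move=> [x y] /=; rewrite /ellipse_eqn/=; field; rewrite s1 t1.
Qed.

(** Diagonalization of the form: [(u, v)] is a unit eigenvector, [p] and [q] are the eigenvalues,
    and the semi-axes are their inverse square roots. *)
Lemma ellipse_of_quadratic (R : realType) (c : plane R) (A B C : R) :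
  0 < C -> 0 < A * C - B ^+ 2 ->
  exists2 D : ellipse R, ellipse_center D = c &
    forall X, ellipse_eqn D X =
      A * (X.1 - c.1) ^+ 2 + 2 * B * (X.1 - c.1) * (X.2 - c.2)
        + C * (X.2 - c.2) ^+ 2.
Proof.
move=> C0 D0.
have A0 : 0 < A.
  by rewrite -(pmulr_lgt0 _ C0); have := sqr_ge0 B; lra.
suff [u [v [p [q [uv p0 q0 [AE BE CE]]]]]] : exists u v p q : R,
    [/\ u ^+ 2 + v ^+ 2 = 1, 0 < p, 0 < q &
     [/\ A = p * u ^+ 2 + q * v ^+ 2, B = (p - q) * u * v &
         C = p * v ^+ 2 + q * u ^+ 2]].
  have sp : 0 < (Num.sqrt p)^-1 by rewrite invr_gt0 sqrtr_gt0.
  have sq : 0 < (Num.sqrt q)^-1 by rewrite invr_gt0 sqrtr_gt0.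
  exists (@Ellipse R c (u, v) _ _ uv sp sq) => // X; rewrite /ellipse_eqn/=.
  rewrite !invrK !exprMn !sqr_sqrtr ?ltW// AE BE CE; ring.
have [B0|B0] := eqVneq B 0.
  by exists 1, 0, A, C; split => //; [ring | split; rewrite ?B0; ring].
(* This is the characteristic equation at [A + w], with eigenvector [(B, w)]; since [B != 0], the
   larger root is positive. *)
have [w w0 wE] : exists2 w, 0 < w & w ^+ 2 + (A - C) * w = B ^+ 2.
  set S : R := Num.sqrt ((A - C) ^+ 2 + 4 * B ^+ 2).
  have SE : S ^+ 2 = (A - C) ^+ 2 + 4 * B ^+ 2.
    by rewrite sqr_sqrtr//; have := sqr_ge0 (A - C); have := sqr_ge0 B; lra.
  have S0 : 0 <= S := sqrtr_ge0 _.
  have B2 : 0 < B ^+ 2 by rewrite lt0r sqrf_eq0 B0 sqr_ge0.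
  exists ((C - A + S) / 2); last by move: SE; lra.
  rewrite divr_gt0//; have [|AC] := ltP (A - C) 0; first by lra.
  suff : A - C < S by lra.
  by rewrite -(ltr_pXn2r (n := 2)) ?nnegrE// SE; lra.
have w1 := lt0r_neq0 w0.
have {wE}CE : C = A + w - B ^+ 2 / w by rewrite -wE; field.
have [n n0 n2] : exists2 n, n != 0 & n ^+ 2 = B ^+ 2 + w ^+ 2.
  exists (Num.sqrt (B ^+ 2 + w ^+ 2)); last first.
    by rewrite sqr_sqrtr// addr_ge0 ?sqr_ge0.
  by rewrite lt0r_neq0// sqrtr_gt0 ltr_wpDl ?sqr_ge0// exprn_gt0.
have div_n2 X : X = X * (B ^+ 2 + w ^+ 2) / n ^+ 2.
  by rewrite -n2 mulfK// expf_neq0.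
(* The second eigenvalue is positive because its product with [A + w] is the determinant. *)
exists (B / n), (w / n), (A + w), (A - B ^+ 2 / w); split.
- by rewrite [RHS]div_n2; field.
- exact: addr_gt0.
- rewrite -(pmulr_rgt0 _ (addr_gt0 A0 w0)); move: D0; congr (0 < _).
  by rewrite CE; field.
- by split; rewrite [LHS]div_n2 ?CE; field; rewrite n0 w1.
Qed.

Lemma area_ellipse_region (R : realType) (D : ellipse R) :
  area (ellipse_region D) = unit_disk_area R * (semi1 D * semi2 D).
Proof.
have [A [B [C [C0 DE eqnE]]]] := ellipse_eqn_quadratic D.
have s0 := mulr_gt0 (semi1_gt0 D) (semi2_gt0 D).
rewrite /ellipse_region; under eq_set do rewrite eqnE.
rewrite area_quadratic_region ?DE ?invr_gt0 ?exprn_gt0//.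
by rewrite sqrtrV ?exprn_ge0 ?ltW// sqrtr_sqr gtr0_norm// invrK.
Qed.

Lemma area_circle_region (R : realType) (w : circle R) :
  area (circle_region w) = unit_disk_area R * circle_radius w ^+ 2.
Proof.
have r0 := circle_radius_gt0 w; set r := circle_radius w in r0 *.
rewrite /circle_region (_ : mkset _ = [set X |
  r ^- 2 * (X.1 - (circle_center w).1) ^+ 2
  + 2 * 0 * (X.1 - (circle_center w).1) * (X.2 - (circle_center w).2)
  + r ^- 2 * (X.2 - (circle_center w).2) ^+ 2 <= 1]%classic); last first.
  apply: eq_set => X; rewrite /circle_eqn -/r; congr (is_true (_ <= 1)).
  by field; exact: lt0r_neq0.
rewrite area_quadratic_region ?expr0n ?subr0 ?mulr_gt0 ?invr_gt0 ?exprn_gt0//.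
by rewrite -expr2 sqrtr_sqr ger0_norm ?invrK// invr_ge0 exprn_ge0// ltW.
Qed.

(** * Tangent lines *)

Definition dot (R : realType) (P Q X : plane R) : R :=
  (Q.1 - P.1) * (X.1 - P.1) + (Q.2 - P.2) * (X.2 - P.2).

Definition sqdist (R : realType) (P Q : plane R) : R := dot P Q Q.

Definition foot (R : realType) (P Q X : plane R) : plane R :=
  (P.1 + dot P Q X / sqdist P Q * (Q.1 - P.1),
   P.2 + dot P Q X / sqdist P Q * (Q.2 - P.2)).

Lemma sqdist_ge0 (R : realType) (P Q : plane R) : 0 <= sqdist P Q.
Proof. by rewrite /sqdist /dot -!expr2 addr_ge0 ?sqr_ge0. Qed.

Lemma sqdistC (R : realType) (P Q : plane R) : sqdist P Q = sqdist Q P.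
Proof. rewrite /sqdist /dot; ring. Qed.

Lemma sqdist_eq0 (R : realType) (P Q : plane R) : sqdist P Q = 0 -> P = Q.
Proof.
case: P Q => [p1 p2] [q1 q2]; rewrite /sqdist /dot /= -!expr2 => /eqP.
rewrite paddr_eq0 ?sqr_ge0// !sqrf_eq0 !subr_eq0.
by case/andP => /eqP-> /eqP->.
Qed.

Lemma orientC (R : realType) (P Q X : plane R) : orient Q P X = - orient P Q X.
Proof. rewrite /orient; ring. Qed.

Lemma orient_cycle (R : realType) (P Q X : plane R) :
  orient Q X P = orient P Q X.
Proof. rewrite /orient; ring. Qed.

(** Lagrange's identity for the vectors PQ and PX. *)
Lemma sqr_orient (R : realType) (P Q X : plane R) :
  orient P Q X ^+ 2 = sqdist P Q * sqdist P X - dot P Q X ^+ 2.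
Proof. rewrite /sqdist /dot /orient; ring. Qed.

Lemma sqdist_gt0 (R : realType) (P Q X : plane R) :
  orient P Q X != 0 -> 0 < sqdist P Q.
Proof.
move=> n0; rewrite lt0r sqdist_ge0 andbT.
apply: contra n0 => /eqP/sqdist_eq0 ->.
by apply/eqP; rewrite /orient; ring.
Qed.

Lemma on_circleP (R : realType) (w : circle R) (X : plane R) :
  on_circle w X <-> sqdist (circle_center w) X = circle_radius w ^+ 2.
Proof.
have r0 : circle_radius w ^+ 2 != 0.
  by rewrite expf_neq0// lt0r_neq0// circle_radius_gt0.
rewrite /on_circle/= /circle_eqn /sqdist /dot -!expr2; split => [|->].
  by move/(congr1 ( *%R^~ (circle_radius w ^+ 2))); rewrite divfK ?mul1r.
by rewrite divff.
Qed.

Section tangent_line.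
Variables (R : realType) (P Q : plane R).
Hypothesis PQ : 0 < sqdist P Q.

Lemma line_foot (X : plane R) : line P Q (foot P Q X).
Proof. rewrite /line/= /foot /orient/=; ring. Qed.

Lemma sqdist_foot (X : plane R) :
  sqdist X (foot P Q X) = orient P Q X ^+ 2 / sqdist P Q.
Proof.
move: (lt0r_neq0 PQ); rewrite /foot /sqdist /dot /orient/= => PQ0.
by field.
Qed.

Lemma pythagoras_foot (X Y : plane R) : line P Q Y ->
  sqdist X Y = sqdist X (foot P Q X) + sqdist (foot P Q X) Y.
Proof.
move=> PQY; have : sqdist P Q * (sqdist X Y - sqdist X (foot P Q X)
    - sqdist (foot P Q X) Y) = - 2 * orient P Q X * orient P Q Y.
  move: (lt0r_neq0 PQ); rewrite /foot /sqdist /dot /orient/= => PQ0.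
  by field.
rewrite PQY mulr0 => /eqP; rewrite mulf_eq0 (gt_eqF PQ)/= => /eqP; lra.
Qed.

(** Both sides say that the foot of the perpendicular from the center is at distance the radius from
    the center. *)
Lemma tangent_lineP (w : circle R) : tangent_line P Q w <->
  orient P Q (circle_center w) ^+ 2 = circle_radius w ^+ 2 * sqdist P Q.
Proof.
have PQ0 := lt0r_neq0 PQ; set c := circle_center w; set r := circle_radius w.
have -> : (orient P Q c ^+ 2 = r ^+ 2 * sqdist P Q) <->
    sqdist c (foot P Q c) = r ^+ 2.
  by rewrite sqdist_foot; split => [->|<-]; rewrite ?mulfK ?divfK.
split=> [[X [[PQX /on_circleP wX] uX]]|cf].
  pose f := foot P Q c.
  (* The mirror image of [X] in the foot is also a common point, so uniqueness forces [X] to be the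
     foot. *)
  pose Y : plane R := (2 * f.1 - X.1, 2 * f.2 - X.2).
  have PQf : orient P Q f = 0 := line_foot c.
  have PQY : line P Q Y.
    rewrite /line/=; transitivity (2 * orient P Q f - orient P Q X).
      by rewrite /orient/=; ring.
    by rewrite PQf PQX; ring.
  have wY : on_circle w Y.
    apply/on_circleP; rewrite -wX (pythagoras_foot c PQX).
    rewrite (pythagoras_foot c PQY) -/f; congr (_ + _).
    by rewrite /sqdist /dot/=; ring.
  have {uX} XY := uX _ (conj PQY wY).
  have -> : foot P Q c = X; last by [].
  have [] : X.1 = Y.1 /\ X.2 = Y.2 by rewrite -XY.
  rewrite /Y/= -/f (surjective_pairing f) (surjective_pairing X)/= => h1 h2.
  by congr pair; lra.
exists (foot P Q c); split.
  by split; [exact: line_foot | apply/on_circleP].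
move=> Y [PQY /on_circleP]; rewrite (pythagoras_foot _ PQY) -/c -/r cf => h.
by apply: sqdist_eq0; move: h; lra.
Qed.

End tangent_line.

(* The tangents from [P] touch the circle at the common distance
   [sqrt (|Pc|^2 - r^2)] from [P], so positivity of both dot products puts [c]
   inside the angle at [P]. *)
Lemma inside_angle (R : realType) (P Q X c : plane R) (r : R) :
  orient P Q X != 0 ->
  orient P Q c ^+ 2 = r ^+ 2 * sqdist P Q ->
  orient P X c ^+ 2 = r ^+ 2 * sqdist P X ->
  0 < dot P Q c -> 0 < dot P X c -> same_side P Q X c.
Proof.
move=> N0 tQ tX dQ dX; rewrite /same_side.
have N2 : 0 < orient P Q X ^+ 2 by rewrite exprn_even_gt0.
have PQ0 := sqdist_gt0 N0.
have PX0 : 0 < sqdist P X.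
  apply: (@sqdist_gt0 _ _ _ Q).
  by rewrite -orient_cycle orientC orient_cycle oppr_eq0.
have -> : orient P Q X * orient P Q c
    = sqdist P Q * dot P X c - dot P Q c * dot P Q X.
  by rewrite /orient /sqdist /dot; ring.
(* If the angle at [P] is not acute, the signs decide. Otherwise the two products are compared
   through their squares, which tangency makes explicit. *)
have [XQ|XQ] := leP (dot P Q X) 0.
  by have := mulr_gt0 PQ0 dX; nra.
rewrite subr_gt0 -(ltr_pXn2r (n := 2)) ?nnegrE ?mulr_ge0 ?ltW// !exprMn.
have eQ : dot P Q c ^+ 2 = (sqdist P c - r ^+ 2) * sqdist P Q.
  by move: tQ; rewrite sqr_orient; lra.
have eX : dot P X c ^+ 2 = (sqdist P c - r ^+ 2) * sqdist P X.
  by move: tX; rewrite sqr_orient; lra.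
have k0 : 0 < sqdist P c - r ^+ 2.
  by rewrite -(pmulr_lgt0 _ PQ0) -eQ exprn_gt0.
rewrite eX eQ -subr_gt0.
have -> : sqdist P Q ^+ 2 * ((sqdist P c - r ^+ 2) * sqdist P X) -
  (sqdist P c - r ^+ 2) * sqdist P Q * dot P Q X ^+ 2 =
  (sqdist P c - r ^+ 2) * sqdist P Q * orient P Q X ^+ 2.
  by rewrite sqr_orient; ring.
by apply: mulr_gt0 => //; exact: mulr_gt0.
Qed.

(** * Chords of the outer ellipse tangent to the inner circle *)

Lemma ellipse_eqn_lt1 (R : realType) (E : ellipse R) (w : circle R)
    (X : plane R) :
  circle_center w = ellipse_center E ->
  circle_radius w < semi1 E -> circle_radius w < semi2 E ->
  on_circle w X -> ellipse_eqn E X < 1.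
Proof.
case: E w => [c [u v] s t /= huv s0 t0] [c' r r0] /= -> rs rt.
move/on_circleP => /=; rewrite /ellipse_eqn/= /sqdist /dot/=.
set x := X.1 - _; set y := X.2 - _ => xy.
have r20 : 0 < r ^+ 2 by rewrite exprn_gt0.
have rs2 : r ^+ 2 < s ^+ 2 by rewrite ltr_pXn2r ?nnegrE ?ltW.
have rt2 : r ^+ 2 < t ^+ 2 by rewrite ltr_pXn2r ?nnegrE ?ltW.
(* Passing to the axes is a rotation, so the squares still sum to [r ^+ 2]; the weights [s ^- 2] and
   [t ^- 2] are both below [r ^- 2]. *)
have xyE : (x * u + y * v) ^+ 2 + (y * u - x * v) ^+ 2 = r ^+ 2.
  by rewrite -xy -[RHS]mulr1 -huv; ring.
have s20 : 0 < s ^- 2 by rewrite invr_gt0 exprn_gt0.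
have t20 : 0 < t ^- 2 by rewrite invr_gt0 exprn_gt0.
have hs : r ^+ 2 * s ^- 2 < 1 by rewrite ltr_pdivrMr ?exprn_gt0// mul1r.
have ht : r ^+ 2 * t ^- 2 < 1 by rewrite ltr_pdivrMr ?exprn_gt0// mul1r.
rewrite !expr_div_n.
set p := (_ + _) ^+ 2 in xyE *; set q := (_ - _) ^+ 2 in xyE *.
have p0 : 0 <= p := sqr_ge0 _. have q0 : 0 <= q := sqr_ge0 _.
move: (s ^- 2) (t ^- 2) s20 t20 hs ht => a b a0 b0 ha hb.
rewrite -(ltr_pM2l r20) mulr1 -[ltRHS]xyE.
have [p1|p1] := ltP 0 p; nra.
Qed.

(** The tangency point is the foot of the center on PQ and lies inside the ellipse. Along the line
    PQ the equation takes the value 1 - k (1 - k) V with [0 <= V], so a value below 1 forces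
    [0 < k]. *)
Lemma touch_dot_gt0 (R : realType) (E : ellipse R) (w : circle R)
    (P Q : plane R) :
  circle_center w = ellipse_center E ->
  circle_radius w < semi1 E -> circle_radius w < semi2 E ->
  0 < sqdist P Q -> on_ellipse E P -> on_ellipse E Q -> 
  orient P Q (circle_center w) ^+ 2 = circle_radius w ^+ 2 * sqdist P Q ->
  0 < dot P Q (circle_center w).
Proof.
move=> cE r1 r2 PQ EP EQ tPQ; have PQ0 := lt0r_neq0 PQ.
set c := circle_center w.
have : ellipse_eqn E (foot P Q c) < 1.
  apply: (ellipse_eqn_lt1 cE) => //; apply/on_circleP.
  by rewrite sqdist_foot// tPQ mulfK.
rewrite /foot; set k := dot P Q c / _.
suff : ellipse_eqn E (P.1 + k * (Q.1 - P.1), P.2 + k * (Q.2 - P.2)) =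
   1 - k * (1 - k) * ellipse_eqn E ((ellipse_center E).1 + (Q.1 - P.1),
                                (ellipse_center E).2 + (Q.2 - P.2)).
  have : 0 <= ellipse_eqn E ((ellipse_center E).1 + (Q.1 - P.1),
                                (ellipse_center E).2 + (Q.2 - P.2)).
    by rewrite /ellipse_eqn addr_ge0 ?sqr_ge0.
  move: (ellipse_eqn _ _) => V V0 ->; rewrite gtrBl => h.
  suff k0 : 0 < k by rewrite -(divfK PQ0 (dot P Q c)) mulr_gt0.
  rewrite ltNge; apply/negP => k0; move: h; apply/negP; rewrite -leNgt; nra.
set V := ellipse_eqn E ((ellipse_center E).1 + _, _).
transitivity ((1 - k) * ellipse_eqn E P + k * ellipse_eqn E Q
  - k * (1 - k) * V).
  by rewrite /V /ellipse_eqn/=; ring.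
by rewrite EP EQ; ring.
Qed.

(** * Circumellipses *)

Lemma orient_sum (R : realType) (P Q X c : plane R) :
  orient P Q c + orient Q X c + orient X P c = orient P Q X.
Proof. rewrite /orient; ring. Qed.

(** With vectors taken from [c], evaluating the form on u X = -(v P + w Q) gives one equation for
    the polar value [k], and the Gram determinant of P and Q gives another; [k] is then
    eliminated. *)
Lemma circumellipse_det (R : realType) (P Q X c : plane R) (D : ellipse R) :
  ellipse_center D = c -> on_ellipse D P -> on_ellipse D Q -> on_ellipse D X ->
  let N := orient P Q X in
  4 * (orient P Q c * orient Q X c * orient X P c) ^+ 2 =
  (semi1 D * semi2 D) ^+ 2 * (N * (N - 2 * orient P Q c) *
    (N - 2 * orient Q X c) * (N - 2 * orient X P c)).
Proof.
move=> cD; have [A [B [C [_ detE eqnE]]]] := ellipse_eqn_quadratic D.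
rewrite /on_ellipse/= !eqnE cD /= => EP EQ EX.
rewrite -(orient_sum P Q X c).
have -> : orient P Q c = (P.1 - c.1) * (Q.2 - c.2) - (P.2 - c.2) * (Q.1 - c.1).
  by rewrite /orient; ring.
have -> : orient Q X c = (Q.1 - c.1) * (X.2 - c.2) - (Q.2 - c.2) * (X.1 - c.1).
  by rewrite /orient; ring.
have -> : orient X P c = (X.1 - c.1) * (P.2 - c.2) - (X.2 - c.2) * (P.1 - c.1).
  by rewrite /orient; ring.
move: EP EQ EX.
move: (P.1 - c.1) (P.2 - c.2) (Q.1 - c.1) (Q.2 - c.2) (X.1 - c.1) (X.2 - c.2).
move=> p1 p2 q1 q2 x1 x2 EP EQ EX.
set u := p1 * q2 - p2 * q1; set v := q1 * x2 - q2 * x1.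
set w := x1 * p2 - x2 * p1.
(* [k] is the polar form of the ellipse at P and Q; as [u X + v P + w Q = 0] it
   is determined by [u], [v], [w]. *)
pose k := A * p1 * q1 + B * (p1 * q2 + p2 * q1) + C * p2 * q2.
have uE : u ^+ 2 = v ^+ 2 + w ^+ 2 + 2 * v * w * k.
  rewrite -[LHS]mulr1 -[in LHS]EX -[v ^+ 2]mulr1 -[w ^+ 2]mulr1.
  rewrite -[in X in _ = X + _ + _]EP -[in X in _ = _ + X + _]EQ /k /u /v /w.
  by ring.
have kE : 1 - k ^+ 2 = (semi1 D * semi2 D) ^- 2 * u ^+ 2.
  rewrite -detE -[X in X - _ = _]mulr1.
  by rewrite -[X in X * _ - _ = _]EP -[X in _ * X - _ = _]EQ /k /u; ring.
have -> : (u + v + w) * (u + v + w - 2 * u) * (u + v + w - 2 * v)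
   * (u + v + w - 2 * w)
   = 4 * v ^+ 2 * w ^+ 2 - (u ^+ 2 - v ^+ 2 - w ^+ 2) ^+ 2.
  by ring.
have -> : u ^+ 2 - v ^+ 2 - w ^+ 2 = 2 * v * w * k by rewrite uE; ring.
transitivity ((semi1 D * semi2 D) ^+ 2 * (4 * v ^+ 2 * w ^+ 2 * (1 - k ^+ 2))).
  by rewrite kE; field; rewrite !lt0r_neq0 ?semi1_gt0 ?semi2_gt0.
by ring.
Qed.

(** The computation of [circumellipse_det] run backwards: [k] is solved for, and positivity of the
    product says [k ^+ 2 < 1], which makes the form definite. *)
Lemma circumellipse_exists (R : realType) (P Q X c : plane R) :
  let N := orient P Q X in
  orient P Q c != 0 -> orient Q X c != 0 -> orient X P c != 0 ->
  0 < N * (N - 2 * orient P Q c) * (N - 2 * orient Q X c)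
      * (N - 2 * orient X P c) ->
  exists2 D : ellipse R, ellipse_center D = c &
    [/\ on_ellipse D P, on_ellipse D Q & on_ellipse D X].
Proof.
rewrite /= -(orient_sum P Q X c).
have -> : orient P Q c = (P.1 - c.1) * (Q.2 - c.2) - (P.2 - c.2) * (Q.1 - c.1).
  by rewrite /orient; ring.
have -> : orient Q X c = (Q.1 - c.1) * (X.2 - c.2) - (Q.2 - c.2) * (X.1 - c.1).
  by rewrite /orient; ring.
have -> : orient X P c = (X.1 - c.1) * (P.2 - c.2) - (X.2 - c.2) * (P.1 - c.1).
  by rewrite /orient; ring.
set u := _ - (P.2 - _) * _; set v := _ - (Q.2 - _) * _.
set w := _ - (X.2 - _) * _ => u0 v0 w0.
pose k := (u ^+ 2 - v ^+ 2 - w ^+ 2) / (2 * v * w).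
have -> : (u + v + w) * (u + v + w - 2 * u) * (u + v + w - 2 * v)
   * (u + v + w - 2 * w) = (2 * v * w) ^+ 2 * (1 - k ^+ 2).
  by rewrite /k; field; rewrite v0 w0.
rewrite pmulr_rgt0 ?exprn_even_gt0 ?mulf_neq0//= => k1.
have uE : u ^+ 2 = v ^+ 2 + w ^+ 2 + 2 * v * w * k.
  by rewrite /k; field; rewrite v0 w0.
have u20 : 0 < u ^+ 2 by rewrite exprn_even_gt0.
(* [A], [B], [C] are the coefficients of the form with value 1 at P and at Q and polar value [k],
   found by expressing a vector in the basis P, Q. *)
pose A := ((P.2 - c.2) ^+ 2 + (Q.2 - c.2) ^+ 2
  - 2 * k * (P.2 - c.2) * (Q.2 - c.2)) / u ^+ 2.
pose B := (k * ((P.1 - c.1) * (Q.2 - c.2) + (P.2 - c.2) * (Q.1 - c.1))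
  - (P.1 - c.1) * (P.2 - c.2) - (Q.1 - c.1) * (Q.2 - c.2)) / u ^+ 2.
pose C := ((P.1 - c.1) ^+ 2 + (Q.1 - c.1) ^+ 2
  - 2 * k * (P.1 - c.1) * (Q.1 - c.1)) / u ^+ 2.
have detE : A * C - B ^+ 2 = (1 - k ^+ 2) / u ^+ 2.
  move: (u0); rewrite /A /B /C /u => u0'; by field.
have det0 : 0 < A * C - B ^+ 2 by rewrite detE divr_gt0.
have C0 : 0 < C.
  rewrite divr_gt0//.
  have -> : (P.1 - c.1) ^+ 2 + (Q.1 - c.1) ^+ 2
     - 2 * k * (P.1 - c.1) * (Q.1 - c.1)
   = (P.1 - c.1 - k * (Q.1 - c.1)) ^+ 2 + (1 - k ^+ 2) * (Q.1 - c.1) ^+ 2.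
    by ring.
  have [Q0|Q0] := eqVneq (Q.1 - c.1) 0; last first.
    by rewrite ltr_wpDl ?sqr_ge0// mulr_gt0// exprn_even_gt0.
  rewrite Q0 mulr0 subr0 expr0n mulr0 addr0 exprn_even_gt0//=.
  by apply: contra u0 => /eqP P0; rewrite /u P0 Q0; apply/eqP; ring.
have [D cD eqnD] := ellipse_of_quadratic c C0 det0.
exists D => //.
have [EP EQ] : on_ellipse D P /\ on_ellipse D Q.
  move: (u0); rewrite /on_ellipse/= !eqnD /A /B /C /u => u0'.
  by split; field.
split=> //; rewrite /on_ellipse/= eqnD.
move: EP EQ; rewrite /on_ellipse/= !eqnD => EP EQ.
have kE : A * (P.1 - c.1) * (Q.1 - c.1)
   + B * ((P.1 - c.1) * (Q.2 - c.2) + (P.2 - c.2) * (Q.1 - c.1))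
   + C * (P.2 - c.2) * (Q.2 - c.2) = k.
  move: (u0); rewrite /A /B /C /u; move: (k) => k' u0'.
  by field.
(* Multiplied by [u ^+ 2], the value at X becomes the value at v P + w Q. *)
apply: (mulfI (lt0r_neq0 u20)); rewrite mulr1 [RHS]uE -[in RHS]kE.
rewrite -[v ^+ 2]mulr1 -[w ^+ 2]mulr1.
rewrite -[in X in _ = X + _ + _]EP -[in X in _ = _ + X + _]EQ /u /v /w.
by ring.
Qed.

(** * Circumcenter, barycentric coordinates and Heron's formula *)

Lemma circumcircle_eq (R : realType) (P Q X c : plane R) :
  sqdist c P = sqdist c Q -> sqdist c P = sqdist c X ->
  4 * orient P Q X ^+ 2 * sqdist c P = sqdist P Q * sqdist Q X * sqdist X P.
Proof.
rewrite (sqdistC c P) => hQ hX.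
pose a := dot P c Q; pose b := dot P c X.
have aE : 2 * a = sqdist P Q.
  by move: hQ; rewrite /a /sqdist /dot; lra.
have bE : 2 * b = sqdist X P.
  by move: hX; rewrite /b /sqdist /dot; lra.
rewrite -aE -bE.
(* By Cramer's rule the two squared terms are the coordinates of [orient P Q X] times the vector
   from P to c. *)
transitivity (4 * ((a * (X.2 - P.2) - b * (Q.2 - P.2)) ^+ 2
                + (b * (Q.1 - P.1) - a * (X.1 - P.1)) ^+ 2)).
  by rewrite /a /b /orient /sqdist /dot; ring.
rewrite [LHS](_ : _ = 4 * (a ^+ 2 * sqdist X P + b ^+ 2 * sqdist P Q
   - 2 * a * b * dot P Q X)); last first.
  by rewrite /sqdist /dot; ring.
have -> : sqdist Q X = sqdist X P + sqdist P Q - 2 * dot P Q X.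
  by rewrite /sqdist /dot; ring.
by rewrite -aE -bE; ring.
Qed.

Lemma circumcenter_exists (R : realType) (P Q X : plane R) :
  orient P Q X != 0 ->
  exists2 c, sqdist c P = sqdist c Q & sqdist c P = sqdist c X.
Proof.
move=> N0; pose a := sqdist P Q / 2; pose b := sqdist P X / 2.
exists (P.1 + (a * (X.2 - P.2) - b * (Q.2 - P.2)) / orient P Q X,
        P.2 + (b * (Q.1 - P.1) - a * (X.1 - P.1)) / orient P Q X);
  by move: N0; rewrite /a /b /orient /sqdist /dot/= => N0; field.
Qed.

Lemma barycentric_exists (R : realType) (P Q X : plane R) (u v w : R) :
  u + v + w = 1 ->
  exists c, [/\ orient P Q c = w * orient P Q X,
    orient Q X c = u * orient P Q X & orient X P c = v * orient P Q X].
Proof.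
move=> /(canRL (addrK _)) uv.
exists (u * P.1 + v * Q.1 + w * X.1, u * P.2 + v * Q.2 + w * X.2).
have -> : u = 1 - w - v by rewrite -uv; ring.
by split; rewrite /orient/=; ring.
Qed.

(** By the law of cosines the bracket is twice [dot P Q X], so this is four times Lagrange's
    identity. *)
Lemma heron (R : realType) (P Q X : plane R) :
  4 * sqdist P Q * sqdist X P - (sqdist P Q + sqdist X P - sqdist Q X) ^+ 2
  = 4 * orient P Q X ^+ 2.
Proof. rewrite /orient /sqdist /dot; ring. Qed.

(** * Triangles *)

Lemma ord3_add11 (i : 'I_3) : i + 1 + 1 = i - 1.
Proof. by rewrite -addrA; congr (_ + _); exact: val_inj. Qed.

Lemma ord3_sub11 (i : 'I_3) : i - 1 - 1 = i + 1.
Proof. by rewrite -addrA; congr (_ + _); exact: val_inj. Qed.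

Definition ord3E := (ord3_add11, ord3_sub11, addrK, subrK).

Lemma ord3_cases (i j : 'I_3) : [\/ j = i, j = i + 1 | j = i - 1].
Proof.
have : [|| j == i, j == i + 1 | j == i - 1].
  by case: i j => [[|[|[|//]]] ?] [[|[|[|//]]] ?].
by case/or3P => /eqP ->; [apply: Or31 | apply: Or32 | apply: Or33].
Qed.

Lemma ord3_neqD1 (i : 'I_3) : i + 1 != i.
Proof. by case: i => [[|[|[|//]]] ?]. Qed.

Lemma ord3_neqB1 (i : 'I_3) : i - 1 != i.
Proof. by case: i => [[|[|[|//]]] ?]. Qed.

(** Expansion may start at any index, so formulas attached to the vertex [i] avoid a case split. *)
Lemma big_ord3 (V : Type) (idx : V) (op : Monoid.com_law idx)
    (F : 'I_3 -> V) (i : 'I_3) :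
  \big[op/idx]_(j < 3) F j = op (op (F i) (F (i + 1))) (F (i - 1)).
Proof.
rewrite (bigD1 i)//= (bigD1 (i + 1)) ?ord3_neqD1//= (bigD1 (i - 1))/=.
  rewrite big1 ?Monoid.mulm1 ?Monoid.mulmA// => j /andP[/andP[ji ji1] ji2].
  by case: (ord3_cases i j) ji ji1 ji2 => ->; rewrite eqxx.
by rewrite ord3_neqB1/= -ord3_add11 ord3_neqD1.
Qed.

Section triangle.
Variables (R : realType) (T : 'I_3 -> plane R).

Definition side (i : 'I_3) : R := Num.sqrt (sqdist (T (i + 1)) (T (i - 1))).

Definition perimeter : R := \sum_(i < 3) side i.

Definition dbl_area : R := `|orient (T 0) (T 1) (T (- 1))|.

(** Unnormalized barycentric coordinate of [c]. Its sign depends on the orientation of [T]; the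
    product with [N] does not. *)
Definition bary (c : plane R) (i : 'I_3) : R :=
  orient (T (i + 1)) (T (i - 1)) c.

Lemma orient_triangle (i : 'I_3) :
  orient (T i) (T (i + 1)) (T (i - 1)) = orient (T 0) (T 1) (T (- 1)).
Proof.
have e : 1 + 1 = -1 :> 'I_3 by exact: val_inj.
case: (ord3_cases 0 i) => ->; rewrite ?ord3E ?add0r ?sub0r ?e ?subrr ?addNr //.
- exact: orient_cycle.
- exact/esym/orient_cycle.
Qed.

Let N := orient (T 0) (T 1) (T (- 1)).

Lemma bary_sum (c : plane R) (i : 'I_3) :
  bary c i + bary c (i + 1) + bary c (i - 1) = N.
Proof.
rewrite /bary !ord3E /N -(orient_triangle i) -[RHS](orient_sum _ _ _ c).
by rewrite addrC addrA.
Qed.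

Hypothesis TN : nondegenerate_triangle T.

Lemma dbl_area_gt0 : 0 < dbl_area.
Proof. by rewrite normr_gt0. Qed.

Lemma sqr_dbl_area : dbl_area ^+ 2 = N ^+ 2.
Proof. by rewrite real_normK// num_real. Qed.

Lemma side_sqr (i : 'I_3) : side i ^+ 2 = sqdist (T (i + 1)) (T (i - 1)).
Proof. exact/sqr_sqrtr/sqdist_ge0. Qed.

Lemma sqdist_side_gt0 (i : 'I_3) : 0 < sqdist (T (i + 1)) (T (i - 1)).
Proof.
by apply: (@sqdist_gt0 _ _ _ (T i)); rewrite orient_cycle orient_triangle.
Qed.

Lemma side_gt0 (i : 'I_3) : 0 < side i.
Proof. by rewrite sqrtr_gt0 sqdist_side_gt0. Qed.

Lemma side_heron (i : 'I_3) :
  perimeter * (side (i + 1) + side (i - 1) - side i)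
    * (side i + side (i + 1) - side (i - 1))
    * (side i + side (i - 1) - side (i + 1)) = 4 * dbl_area ^+ 2.
Proof.
rewrite sqr_dbl_area /N -(orient_triangle i) -heron.
have := side_sqr (i - 1); have := side_sqr (i + 1); have := side_sqr i.
rewrite !ord3E => <- <- <-.
by rewrite /perimeter (big_ord3 _ _ i)/=; ring.
Qed.

(** Otherwise one factor in Heron's formula would be nonpositive and the others nonnegative, against
    a positive area. *)
Lemma side_triangle_lt (i : 'I_3) : side i < side (i + 1) + side (i - 1).
Proof.
have := side_heron i.
have : 0 < dbl_area ^+ 2 by rewrite exprn_gt0// dbl_area_gt0.
have := side_gt0 (i - 1); have := side_gt0 (i + 1); have := side_gt0 i.
rewrite /perimeter (big_ord3 _ _ i)/=.
move: (side i) (side (i + 1)) (side (i - 1)) (dbl_area ^+ 2).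
move=> x y z d x0 y0 z0 d0 h.
rewrite ltNge; apply/negP => yzx.
have : (x + y + z) * (y + z - x) * (x + y - z) * (x + z - y) <= 0.
  rewrite -!mulrA mulrCA; apply: mulr_le0_ge0; first lra.
  by apply: mulr_ge0; [lra | apply: mulr_ge0; lra].
by rewrite h; lra.
Qed.

Lemma perimeter_gt0 : 0 < perimeter.
Proof. by rewrite /perimeter (big_ord3 _ _ 0)/= !addr_gt0 ?side_gt0. Qed.

(** Tangency fixes the coordinates of the center up to sign; the side conditions then choose the
    signs, all positive for the incircle and one negative for an excircle. *)
Lemma tangent_sides_bary (w : circle R) : tangent_to_sides T w <->
  forall i, (N * bary (circle_center w) i) ^+ 2
    = (dbl_area * circle_radius w * side i) ^+ 2.
Proof.
have N0 : N ^+ 2 != 0 by rewrite expf_neq0.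
split=> + i => /(_ i).
  move/(tangent_lineP (sqdist_side_gt0 i)); rewrite -side_sqr => h.
  by rewrite /bary !exprMn h sqr_dbl_area mulrA.
rewrite /bary !exprMn sqr_dbl_area -mulrA => /(mulfI N0); rewrite side_sqr.
by move/(tangent_lineP (sqdist_side_gt0 i)).
Qed.

Lemma same_side_bary (c : plane R) (i : 'I_3) :
  same_side (T (i + 1)) (T (i - 1)) (T i) c <-> 0 < N * bary c i.
Proof. by rewrite /same_side orient_cycle orient_triangle. Qed.

Lemma opposite_sides_bary (c : plane R) (i : 'I_3) :
  opposite_sides (T (i + 1)) (T (i - 1)) (T i) c <-> N * bary c i < 0.
Proof. by rewrite /opposite_sides orient_cycle orient_triangle. Qed.

Lemma dbl_area_side_gt0 (w : circle R) (i : 'I_3) :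
  0 < dbl_area * circle_radius w * side i.
Proof.
apply: mulr_gt0 (side_gt0 i).
by rewrite mulr_gt0 ?dbl_area_gt0 ?circle_radius_gt0.
Qed.

Lemma incircle_bary (w : circle R) : incircle T w <->
  forall i, N * bary (circle_center w) i = dbl_area * circle_radius w * side i.
Proof.
split=> [[/tangent_sides_bary tw sw] i|h].
  apply/eqP; rewrite -(eqrXn2 (n := 2))// ?tw// ltW ?dbl_area_side_gt0//.
  exact/same_side_bary.
split; first by apply/tangent_sides_bary => i; rewrite h.
by move=> i; apply/same_side_bary; rewrite h dbl_area_side_gt0.
Qed.

Lemma excircle_bary (i : 'I_3) (w : circle R) : excircle T i w <->
  [/\ N * bary (circle_center w) i = - (dbl_area * circle_radius w * side i),
    N * bary (circle_center w) (i + 1)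
      = dbl_area * circle_radius w * side (i + 1) &
    N * bary (circle_center w) (i - 1)
      = dbl_area * circle_radius w * side (i - 1)].
Proof.
split=> [[/tangent_sides_bary tw /opposite_sides_bary ow sw]|[h0 h1 h2]].
  have pos j : j != i -> N * bary (circle_center w) j
      = dbl_area * circle_radius w * side j.
    move=> ji; apply/eqP; rewrite -(eqrXn2 (n := 2))// ?tw// ltW//.
      exact/same_side_bary/sw.
    exact: dbl_area_side_gt0.
  split; [|exact/pos/ord3_neqD1 | exact/pos/ord3_neqB1].
  apply/oppr_inj/eqP; rewrite opprK -(eqrXn2 (n := 2))// ?sqrrN ?tw//.
    by rewrite oppr_ge0 ltW.
  by rewrite ltW// dbl_area_side_gt0.
split.
- by apply/tangent_sides_bary => j; case: (ord3_cases i j) => ->;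
    rewrite ?h0 ?h1 ?h2 ?sqrrN.
- by apply/opposite_sides_bary; rewrite h0 oppr_lt0 dbl_area_side_gt0.
- move=> j ji; apply/same_side_bary.
  case: (ord3_cases i j) ji => ->; rewrite ?eqxx// => _.
  + by rewrite h1 dbl_area_side_gt0.
  + by rewrite h2 dbl_area_side_gt0.
Qed.

Lemma incircle_radiusE (w : circle R) :
  incircle T w -> circle_radius w * perimeter = dbl_area.
Proof.
move/incircle_bary => h; apply: (mulfI (lt0r_neq0 dbl_area_gt0)).
rewrite -expr2 sqr_dbl_area [RHS]expr2.
rewrite -[X in _ = _ * X](bary_sum (circle_center w) 0).
by rewrite 2!mulrDr !h /perimeter (big_ord3 _ _ 0)/=; ring.
Qed.

Lemma excircle_radiusE (i : 'I_3) (w : circle R) : excircle T i w ->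
  circle_radius w * (side (i + 1) + side (i - 1) - side i) = dbl_area.
Proof.
case/excircle_bary => h0 h1 h2; apply: (mulfI (lt0r_neq0 dbl_area_gt0)).
rewrite -expr2 sqr_dbl_area [RHS]expr2.
rewrite -[X in _ = _ * X](bary_sum (circle_center w) i).
by rewrite 2![in RHS]mulrDr h0 h1 h2; ring.
Qed.

Lemma circumcircle_radiusE (w : circle R) : circumcircle T w ->
  2 * circle_radius w * dbl_area = \prod_(i < 3) side i.
Proof.
move=> Tw; have r0 := circle_radius_gt0 w.
apply/eqP; rewrite -(eqrXn2 (n := 2))//; last 2 first.
- by rewrite !mulr_ge0// ltW// dbl_area_gt0.
- by apply: prodr_ge0 => i _; rewrite ltW// side_gt0.
apply/eqP; rewrite -prodrXl.
under eq_bigr do rewrite side_sqr.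
rewrite (big_ord3 _ _ 0) ?ord3E/=.
have cE i : sqdist (circle_center w) (T i) = circle_radius w ^+ 2.
  exact/on_circleP.
have := @circumcircle_eq _ (T 0) (T (0 + 1)) (T (0 - 1)) (circle_center w).
rewrite !cE orient_triangle -/N -sqr_dbl_area => /(_ erefl erefl) h.
by rewrite !exprMn mulrAC -natrX h; ring.
Qed.

Lemma circumcircle_exists : exists w, circumcircle T w.
Proof.
have [|c c1 c2] := @circumcenter_exists _ (T 0) (T (0 + 1)) (T (0 - 1)).
  by rewrite orient_triangle.
have cE i : sqdist c (T i) = sqdist c (T 0) by case: (ord3_cases 0 i) => ->.
have r0 : 0 < Num.sqrt (sqdist c (T 0)).
  rewrite sqrtr_gt0 lt0r sqdist_ge0 andbT; apply: contra TN => /eqP c0.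
  have cT i : T i = c by apply/esym/sqdist_eq0; rewrite cE.
  by rewrite !cT /orient !subrr.
exists (@Circle R c _ r0) => i; apply/on_circleP => /=.
by rewrite sqr_sqrtr ?sqdist_ge0.
Qed.

Lemma excircle_exists (i : 'I_3) : exists w, excircle T i w.
Proof.
have m0 := dbl_area_gt0; have m1 := lt0r_neq0 m0.
have k0 : 0 < side (i + 1) + side (i - 1) - side i.
  by rewrite subr_gt0 side_triangle_lt.
have k1 := lt0r_neq0 k0.
have r0 := divr_gt0 m0 k0; set r := dbl_area / _ in r0.
(* The coordinates dictated by [excircle_bary]; the choice of [r] makes their sum 1. *)
have [|c [ca cb cc]] := @barycentric_exists _ (T i) (T (i + 1)) (T (i - 1))
    (- (r * side i / dbl_area)) (r * side (i + 1) / dbl_area)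
    (r * side (i - 1) / dbl_area).
  by rewrite /r; field; rewrite m1 k1.
have NE x : N * (x / dbl_area * N) = dbl_area * x.
  rewrite mulrCA -expr2 -sqr_dbl_area; field; exact: m1.
exists (@Circle R c r r0); apply/excircle_bary => /=.
rewrite /bary !ord3E ca cb cc !orient_triangle -/N mulNr mulrN !NE.
by rewrite !mulrA.
Qed.

(* The barycentric condition for the excenter to be the center of an ellipse,
   reduced to Heron's formula. *)
Lemma excircle_heron (i : 'I_3) (w : circle R) (c := circle_center w) :
  excircle T i w ->
  N ^+ 6 * (N * (N - 2 * bary c (i - 1)) * (N - 2 * bary c i)
    * (N - 2 * bary c (i + 1)))
  = 4 * dbl_area ^+ 8 * circle_radius w ^+ 4.
Proof.
move=> Xw; have rE := excircle_radiusE Xw; have hN := side_heron i.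
have [h0 h1 h2] := (excircle_bary i w).1 Xw.
(* Once [dbl_area] is written through the exradius, each bracket is, up to sign,
   [dbl_area * circle_radius w] times a Heron factor; the fourth Heron factor comes from one
   remaining [dbl_area]. *)
transitivity (N ^+ 2 * N ^+ 2 * (N ^+ 2 - 2 * (N * bary c (i - 1)))
  * (N ^+ 2 - 2 * (N * bary c i)) * (N ^+ 2 - 2 * (N * bary c (i + 1)))).
  by ring.
rewrite h0 h1 h2 -sqr_dbl_area.
transitivity (dbl_area ^+ 6 * circle_radius w ^+ 4 * (4 * dbl_area ^+ 2)).
  rewrite -hN /perimeter (big_ord3 _ _ i)/= -rE; ring.
by ring.
Qed.

Lemma circumellipse_semiE (i : 'I_3) (w : circle R) (D : ellipse R) :
  excircle T i w -> circumellipse T (circle_center w) D ->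
  semi1 D * semi2 D * dbl_area = circle_radius w * \prod_(j < 3) side j.
Proof.
move=> Xw [cD TD].
have r0 := circle_radius_gt0 w; have m0 := dbl_area_gt0.
have s0 := mulr_gt0 (semi1_gt0 D) (semi2_gt0 D).
have l0 : 0 < \prod_(j < 3) side j by apply: prodr_gt0 => j _; exact: side_gt0.
apply/eqP; rewrite -(eqrXn2 (n := 2))//;
  [apply/eqP | exact/ltW/mulr_gt0 | exact/ltW/mulr_gt0].
have := circumellipse_det cD (TD i) (TD (i + 1)) (TD (i - 1)).
have := excircle_heron Xw; have [h0 h1 h2] := (excircle_bary i w).1 Xw.
rewrite orient_triangle -/N; move: h0 h1 h2; rewrite /bary !ord3E.
move: (circle_radius w) r0 => r r0 h0 h1 h2 hh hD.
(* This multiplier makes the right side of [excircle_heron] appear, so that [circumellipse_det] can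
   be substituted. *)
have k0 : 4 * dbl_area ^+ 6 * r ^+ 4 != 0.
  by rewrite !mulf_neq0 ?expf_neq0 ?lt0r_neq0.
apply: (mulfI k0).
transitivity ((semi1 D * semi2 D) ^+ 2 * (4 * dbl_area ^+ 8 * r ^+ 4)).
  by ring.
rewrite -hh mulrCA -hD.
transitivity (4 * ((N * orient (T i) (T (i + 1)) (circle_center w))
  * (N * orient (T (i + 1)) (T (i - 1)) (circle_center w))
  * (N * orient (T (i - 1)) (T i) (circle_center w))) ^+ 2).
  by ring.
by rewrite h0 h1 h2 (big_ord3 _ _ i)/=; ring.
Qed.

(** An excenter lies on no side line, and [excircle_heron] makes the product in
    [circumellipse_exists] positive. *)
Lemma circumellipse_of_excircle_exists (i : 'I_3) (w : circle R) :
  excircle T i w -> exists D, circumellipse T (circle_center w) D.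
Proof.
move=> Xw; have m0 := dbl_area_gt0; have r0 := circle_radius_gt0 w.
have [h0 h1 h2] := (excircle_bary i w).1 Xw.
have bary_neq0 j : bary (circle_center w) j != 0.
  apply/eqP => b0; have := dbl_area_side_gt0 w j.
  case: (ord3_cases i j) b0 => -> b0.
  - by rewrite -[ltRHS]opprK -h0 b0 mulr0 oppr0 ltxx.
  - by rewrite -h1 b0 mulr0 ltxx.
  - by rewrite -h2 b0 mulr0 ltxx.
have [||||D cD [TP TQ TX]] := @circumellipse_exists _ (T i) (T (i + 1))
    (T (i - 1)) (circle_center w).
- by have := bary_neq0 (i - 1); rewrite /bary !ord3E.
- by have := bary_neq0 i.
- by have := bary_neq0 (i + 1); rewrite /bary !ord3E.
- rewrite orient_triangle -/N.
  have N6 : 0 < N ^+ 6 by rewrite exprn_even_gt0.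
  rewrite -(pmulr_rgt0 _ N6); have := excircle_heron Xw.
  rewrite /bary !ord3E => ->.
  by rewrite !mulr_gt0 ?exprn_gt0.
by exists D; split=> // j; case: (ord3_cases i j) => ->.
Qed.

End triangle.

(** * Poncelet triangles and the sum of the area ratios *)

Lemma poncelet_incircle (R : realType) (E : ellipse R) (w : circle R)
    (T : 'I_3 -> plane R) :
  circle_center w = ellipse_center E ->
  circle_radius w < semi1 E -> circle_radius w < semi2 E ->
  poncelet_triangle E w T -> incircle T w.
Proof.
move=> cE r1 r2 [TN ET tT]; split=> // i.
have tan j := (tangent_lineP (sqdist_side_gt0 TN j) w).1 (tT j).
have pos := sqdist_side_gt0 TN.
have tanC j : orient (T (j - 1)) (T (j + 1)) (circle_center w) ^+ 2
    = circle_radius w ^+ 2 * sqdist (T (j - 1)) (T (j + 1)).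
  by rewrite orientC sqrrN sqdistC.
(* The angle used is the one at [T (i + 1)], with arms toward [T (i - 1)] and [T i]. *)
apply: (@inside_angle _ _ _ _ _ (circle_radius w)).
- by rewrite orient_cycle orient_triangle.
- exact: tan.
- by have := tanC (i - 1); rewrite !ord3E.
- by apply: (touch_dot_gt0 cE) => //; exact: tan.
- have := tanC (i - 1); have := pos (i - 1); rewrite !ord3E sqdistC => p t.
  exact: (touch_dot_gt0 cE).
Qed.

Theorem theorem2 (R : realType) (E : ellipse R) (E' : circle R) (a b r : R)
  (ha : semi1 E = a) (hb : semi2 E = b) (hr : circle_radius E' = r)
  (concentric : circle_center E' = ellipse_center E)
  (hab : b < a) (hrb : r < b) (hr0 : 0 < r)
  (hF : poncelet3 E E')
  (P : 'I_3 -> plane R) (hP : poncelet_triangle E E' P) :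
  (exists (C I : circle R) (X : 'I_3 -> circle R) (D : 'I_3 -> ellipse R),
     associated_curves P C I X D) /\
  (forall (C I : circle R) (X : 'I_3 -> circle R) (D : 'I_3 -> ellipse R),
     associated_curves P C I X D ->
     let rho := circle_radius I / circle_radius C in
     rho = r / circle_radius C /\
     \sum_(i < 3) area (ellipse_region (D i)) / area (circle_region (X i))
       = 2 / rho).
Proof.
have PN : nondegenerate_triangle P by case: hP.
have PI : incircle P E'.
  apply: (poncelet_incircle concentric) hP; rewrite hr ?ha ?hb//.
  exact: lt_trans hab.
split.
  have [C PC] := circumcircle_exists PN.
  have [X PX] := choice (excircle_exists PN).
  have [D PD] := choice (fun i => circumellipse_of_excircle_exists PN (PX i)).
  by exists C, E', X, D.
move=> C I X D [PC PI' PX PD] /=.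
have m0 := dbl_area_gt0 PN; have m1 := lt0r_neq0 m0.
have p0 := lt0r_neq0 (perimeter_gt0 PN).
have rI : circle_radius I = dbl_area P / perimeter P.
  by rewrite -(incircle_radiusE PN PI') mulfK.
(* [I] and [E'] are both incircles, so their radii agree. *)
have rE : r = dbl_area P / perimeter P.
  by rewrite -hr -(incircle_radiusE PN PI) mulfK.
split; first by rewrite rI rE.
have CE : circle_radius C = (\prod_(i < 3) side P i) / (2 * dbl_area P).
  by rewrite -(circumcircle_radiusE PN PC); field.
have C0 := lt0r_neq0 (circle_radius_gt0 C).
transitivity (\sum_(i < 3) (\prod_(j < 3) side P j) / dbl_area P ^+ 2
   * (side P (i + 1) + side P (i - 1) - side P i)).
  apply: eq_bigr => i _; rewrite area_ellipse_region area_circle_region.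
  have X0 := lt0r_neq0 (circle_radius_gt0 (X i)).
  have K0 := lt0r_neq0 (unit_disk_area_gt0 R).
  have -> : semi1 (D i) * semi2 (D i) = circle_radius (X i)
      * (\prod_(j < 3) side P j) / dbl_area P.
    by rewrite -(circumellipse_semiE PN (PX i) (PD i)) mulfK.
  have <- : dbl_area P / circle_radius (X i)
      = side P (i + 1) + side P (i - 1) - side P i.
    by rewrite -(excircle_radiusE PN (PX i)) mulrC mulKf.
  by field; rewrite K0 X0 m1.
(* Each side enters twice with a plus sign and once with a minus sign. *)
rewrite -mulr_sumr (_ : \sum_(i < 3) _ = perimeter P); last first.
  by rewrite /perimeter !(big_ord3 _ _ 0)/= !ord3E; ring.
rewrite rI invf_div mulrA; move: C0; rewrite CE => C0.
by field; rewrite p0 m1.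
Qed.
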